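(* Let $1\le d\le n$ and $m=n-d$. The number of elementary abelian regular subgroups $T_\circ\le\mathrm{AGL}(V,+)$ such that $\dim(W(T_\circ))=d$ and $T_+\le\mathrm{AGL}(V,\circ)$ is $$\begin{bmatrix}n\\ d\end{bmatrix}_2\cdot|\mathcal{V}(\mathcal{I}_{m,d})|,$$ where $\begin{bmatrix}n\\ d\end{bmatrix}_2=\prod_{i=0}^{d-1}\frac{2^{n-i}-1}{2^{d-i}-1}$ is the Gaussian binomial, $\mathcal{I}_{m,d}$ is the ideal of the polynomial ring $\mathbb{F}_2\left[b^{(s)}_{i,j}\mid i,s\in[m],\,j\in[d]\right]$ generated by $\mathcal{S}_0\cup\mathcal{S}_1\cup\mathcal{S}_2\cup\mathcal{S}_3$ with $$\mathcal{S}_0=\left\{\left(b^{(s)}_{i,j}\right)^2-b^{(s)}_{i,j}\;\middle|\; i,s\in[m],\,j\in[d]\right\},$$ $$\mathcal{S}_1=\left\{\prod_{i=1}^{m}\prod_{j=1}^{d}\left(1+\sum_{s\in S}b^{(s)}_{i,j}\right)\;\middle|\; S\subseteq[m],\,S\neq\emptyset\right\},$$ $$\mathcal{S}_2=\left\{b^{(s)}_{i,j}-b^{(i)}_{s,j}\;\middle|\; i,s\in[m],\,j\in[d]\right\},$$ $$\mathcal{S}_3=\left\{b^{(i)}_{i,j}\;\middle|\; i\in[m],\,j\in[d]\right\},$$ and $\mathcal{V}(\mathcal{I}_{m,d})$ is the variety of $\mathcal{I}_{m,d}$, i.e. the set of its common zeros.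
   Context: $n\ge 2$ and $V=(\mathbb{F}_2)^n$. $[s]=\{1,\dots,s\}$. Maps are written in postfix notation. $T=T_+=\{\sigma_a\mid a\in V\}$, where $\sigma_a:x\mapsto x+a$, is the translation group; $\mathrm{AGL}(V,+)=\mathrm{GL}(V)\ltimes T$. For an elementary abelian regular subgroup $T_\circ\le\mathrm{Sym}(V)$, write $T_\circ=\{\tau_a\mid a\in V\}$, where $\tau_a$ is the unique element of $T_\circ$ sending $0$ to $a$; the corresponding operation on $V$ is $a\circ b=a\tau_b$, and $\mathrm{AGL}(V,\circ)$ denotes the normaliser of $T_\circ$ in $\mathrm{Sym}(V)$. $W(T_\circ)=\{a\in V\mid\sigma_a\in T_\circ\}$. When $T_\circ\le\mathrm{AGL}(V,+)$, $W(T_\circ)$ is a subspace of $V$. Since $\mathcal{I}_{m,d}$ contains the field equations $\mathcal{S}_0$, all its zeros have coordinates in $\mathbb{F}_2$, so $\mathcal{V}(\mathcal{I}_{m,d})\subseteq(\mathbb{F}_2)^{m^2d}$. *)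

(* Defs.v *)
From mathcomp Require Import all_boot all_fingroup all_algebra all_solvable.
From mathcomp Require Import mpoly boolp.

Set Implicit Arguments.
Unset Strict Implicit.
Unset Printing Implicit Defensive.

Import GRing.Theory.
Local Open Scope ring_scope.

Notation "''V_' n" := 'rV['F_2]_n (at level 8, n at level 2, format "''V_' n").

(* The product of {perm 'V_n} applies its left factor first, as in postfix
   notation. *)
Section Groups.
Variable n : nat.

Definition sigma (a : 'V_n) : {perm 'V_n} := perm (addIr a).

Definition transl : {set {perm 'V_n}} := [set sigma a | a : 'V_n].

Definition GLperm : {set {perm 'V_n}} :=
  [set s : {perm 'V_n} | [exists A : 'M['F_2]_n,
              (A \in unitmx) && [forall x : 'V_n, s x == x *m A]]].

Definition AGL : {set {perm 'V_n}} := (GLperm * transl)%g.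

Definition regular (T : {set {perm 'V_n}}) : bool :=
  [transitive T, on [set: 'V_n] | 'P]
    && [forall x : 'V_n, 'C_T[x | 'P]%g == [1]%g].

(* AGL(V, o), the operation o being determined by the regular group T. *)
Definition AGLo (T : {set {perm 'V_n}}) : {set {perm 'V_n}} := 'N(T)%g.

Definition W (T : {set {perm 'V_n}}) : {set 'V_n} :=
  [set a | sigma a \in T].

(* The span does not enlarge W T when T is a group: see mem_Wspace. *)
Definition Wspace (T : {set {perm 'V_n}}) : {vspace 'V_n} := <<enum (W T)>>%VS.

Definition circ_groups (d : nat) : {set {group {perm 'V_n}}} :=
  [set T : {group {perm 'V_n}} |
     [&& is_abelem T, regular T, T \subset AGL,
         \dim (Wspace T) == d & transl \subset AGLo T]].

Lemma sigmaE a x : sigma a x = x + a.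
Proof. by rewrite permE. Qed.

Lemma mem_Wspace (T : {group {perm 'V_n}}) a : (a \in Wspace T) = (a \in W T).
Proof.
have W0 : 0 \in W T.
  rewrite inE (_ : sigma 0 = 1%g) ?group1 //.
  by apply/permP=> x; rewrite sigmaE addr0 perm1.
have WD x y : x \in W T -> y \in W T -> x + y \in W T.
  rewrite !inE => Tx Ty; rewrite (_ : sigma _ = sigma x * sigma y)%g ?groupM //.
  by apply/permP=> z; rewrite permM !sigmaE addrA.
have WZ (c : 'F_2) x : x \in W T -> c *: x \in W T.
  move=> Wx; case: c => [[|[|//]] lt_c].
    by rewrite (_ : Ordinal _ = 0) ?scale0r //; apply: val_inj.
  by rewrite (_ : Ordinal _ = 1) ?scale1r //; apply: val_inj.
apply/idP/idP=> [aW | Wa]; last by rewrite memv_span ?mem_enum.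
rewrite (@coord_span _ _ _ (in_tuple (enum (W T))) a) //.
apply: (big_ind (fun x => x \in W T)) => // i _; apply: WZ.
by rewrite -mem_enum mem_nth.
Qed.

End Groups.

Section Varieties.
Variable N : nat.
Implicit Types S J : {mpoly 'F_2[N]} -> Prop.

Definition ideal_gen S (p : {mpoly 'F_2[N]}) : Prop :=
  exists (k : nat) (c g : 'I_k -> {mpoly 'F_2[N]}),
    (forall i, S (g i)) /\ p = \sum_(i < k) c i * g i.

(* Zeros with coordinates in F_2; for ideals containing the field equations
   there are no others, see variety_ext. *)
Definition variety J : {set {ffun 'I_N -> 'F_2}} :=
  [set v : {ffun 'I_N -> 'F_2} | `[< forall p, J p -> p.@[v] = 0 >]].

Lemma sub_ideal_gen S p : S p -> ideal_gen S p.
Proof.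
move=> Sp; exists 1%N, (fun=> 1), (fun=> p); split=> //.
by rewrite big_ord1 mul1r.
Qed.

Lemma variety_ext J (K : fieldType) (f : {rmorphism 'F_2 -> K}) (v : 'I_N -> K) :
    (forall i, J ('X_i ^+ 2 - 'X_i)) -> (forall p, J p -> mmap f v p = 0) ->
  exists2 w, w \in variety J & forall i, v i = f (w i).
Proof.
move=> J0 vJ; pose w : {ffun 'I_N -> 'F_2} := [ffun i => (v i != 0)%:R].
have vw i : v i = f (w i).
  have /eqP := vJ _ (J0 i).
  rewrite raddfB /= rmorphXn /= mmapX mmap1U -[X in _ - X]mulr1 expr2 -mulrBr.
  rewrite mulf_eq0 subr_eq0 ffunE => /orP[] /eqP->.
    by rewrite eqxx rmorph0.
  by rewrite oner_eq0 rmorph1.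
exists w => //; rewrite inE; apply/asboolP => p Jp; apply: (fmorph_inj f).
rewrite rmorph0 -(vJ p Jp) mevalE [RHS]/mmap rmorph_sum /=.
apply: eq_bigr => M _; rewrite rmorphM rmorph_prod /=; congr (_ * _).
by apply: eq_bigr => i _; rewrite rmorphXn /= vw.
Qed.

End Varieties.

Section Equations.
Variables m d : nat.

(* bvar s i j stands for b^(s)_(i,j); the m^2 d variables are numbered by an
   arbitrary enumeration of the index triples. *)
Definition nvar : nat := #|{: 'I_m * 'I_m * 'I_d}|.

Definition bvar (s i : 'I_m) (j : 'I_d) : {mpoly 'F_2[nvar]} :=
  'X_(enum_rank (s, i, j)).

Definition calS0 (p : {mpoly 'F_2[nvar]}) : Prop :=
  exists i s j, p = bvar s i j ^+ 2 - bvar s i j.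

Definition calS1 (p : {mpoly 'F_2[nvar]}) : Prop :=
  exists2 S : {set 'I_m}, S != set0 &
    p = \prod_(i < m) \prod_(j < d) (1 + \sum_(s in S) bvar s i j).

Definition calS2 (p : {mpoly 'F_2[nvar]}) : Prop :=
  exists i s j, p = bvar s i j - bvar i s j.

Definition calS3 (p : {mpoly 'F_2[nvar]}) : Prop :=
  exists i j, p = bvar i i j.

Definition Imd : {mpoly 'F_2[nvar]} -> Prop :=
  ideal_gen (fun p => [\/ calS0 p, calS1 p, calS2 p | calS3 p]).

Lemma Imd_field_eq k : Imd ('X_k ^+ 2 - 'X_k).
Proof.
apply: sub_ideal_gen; apply: Or41; case E: (enum_val k) => [[s i] j].
by exists i, s, j; rewrite /bvar -E enum_valK.
Qed.

End Equations.

Arguments Imd : clear implicits.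

Definition gauss_binom (n d : nat) : rat :=
  \prod_(0 <= i < d) ((2 ^+ (n - i) - 1) / (2 ^+ (d - i) - 1)).

(* Main.v *)
Require Import Defs.
From mathcomp Require Import all_boot all_fingroup all_algebra all_solvable mpoly boolp.
From mathcomp Require Import finfield mxabelem.

(** An affine permutation of V taking 0 to a has the form x |-> x + a + x.a,
where x.a is additive in x.  If the tau_a form a regular group T of affine maps,
commutativity of T makes the product symmetric, hence biadditive, and the
relation tau_a ^ 2 = 1 read at 0 gives a.a = 0.  Translations normalise T
exactly when all products (x.y).z vanish: conjugating tau_a by sigma_b replaces
a by a + a.b without changing x |-> x.a.  Conversely a biadditive product
with x.x = 0 and (x.y).z = 0 defines such a group, so the groups to be counted
correspond to these products ([circ_groupsP]), and W T is the radical of the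
product ([W_circ]).

Fix the subspace W of dimension d, and a basis of V whose last d vectors span
it.  A product with radical W takes its values in W and factors through V / W,
so it is an alternating nondegenerate map F_2^m x F_2^m -> F_2^d.  Its
structure constants b^(s)_(i,j) are the points of the variety: S2 and S3 say
that the map is alternating, and S1 says that no nonzero vector, that is no
sum of the basis vectors indexed by a nonempty S, lies in its radical
([varietyP], [card_circ_groups_W]).

It remains to count the subspaces W.  Instead of subspaces the proof counts
bases: the pairs (T, M), with M a d x n matrix whose rows form a basis of W T,
are counted in two ways ([card_circ_groups]).  Both counts use the number of
linearly independent d-tuples in a space ([card_row_free_sub]), and the quotient
of the two numbers is the Gaussian binomial ([gauss_binomE]). *)

Set Implicit Arguments.
Unset Strict Implicit.
Unset Printing Implicit Defensive.

Import GRing.Theory.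
Local Open Scope ring_scope.

(** * Vector spaces over the field with two elements *)

Lemma addF2 (c : 'F_2) : c + c = 0.
Proof. by apply: val_inj; case: c => [[|[|//]] lt_c]. Qed.

Lemma F2_neq0 (c : 'F_2) : c != 0 -> c = 1.
Proof. by case: c => [[|[|//]] lt_c] // _; apply: val_inj. Qed.

Section CharTwo.
Variable n : nat.
Implicit Types x y : 'V_n.

Lemma addVV x : x + x = 0.
Proof. by apply/rowP=> i; rewrite !mxE addF2. Qed.

Lemma oppV x : - x = x.
Proof. by apply/esym/eqP; rewrite -addr_eq0 addVV. Qed.

Lemma addVK x y : x + y + y = x.
Proof. by rewrite -addrA addVV addr0. Qed.

Lemma addV_eq0 x y : x + y = 0 -> x = y.
Proof. by move/eqP; rewrite addr_eq0 oppV => /eqP. Qed.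

(** Scalars being 0 or 1, additive maps are linear. *)
Lemma additive_mx (f : 'V_n -> 'V_n) :
  (forall x y, f (x + y) = f x + f y) -> exists A, forall x, f x = x *m A.
Proof.
move=> fD; have f0 : f 0 = 0 by apply: (addrI (f 0)); rewrite -fD !addr0.
exists (\matrix_i f (delta_mx 0 i)) => x; rewrite mulmx_sum_row.
rewrite {1}[x]row_sum_delta (big_morph f fD f0); apply: eq_bigr => i _.
rewrite rowK; have [->|/F2_neq0->] := eqVneq (x 0 i) 0; first by rewrite !scale0r.
by rewrite !scale1r.
Qed.

End CharTwo.

(** * From nilpotent alternating products to regular groups *)

Section ProductToGroup.
Variable n : nat.
Implicit Types (mu : 'V_n -> 'V_n -> 'V_n) (T : {group {perm 'V_n}}).

Record nil_alternating mu : Prop := NilAlternating {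
  prodDl x y z : mu (x + y) z = mu x z + mu y z;
  prodDr x y z : mu x (y + z) = mu x y + mu x z;
  prodxx x : mu x x = 0;
  prod_nil x y z : mu (mu x y) z = 0
}.

(** The maps x |-> x + a + mu x a. The parameter a is recovered as the image of
0, so that the definition requires no proof that these maps are bijective. *)
Definition circ_set mu : {set {perm 'V_n}} :=
  [set s : {perm 'V_n} | [forall x, s x == x + s 0 + mu x (s 0)]].

Definition radical mu : {set 'V_n} := [set a | [forall x, mu x a == 0]].

Lemma circ_setP mu (s : {perm 'V_n}) :
  reflect (forall x, s x = x + s 0 + mu x (s 0)) (s \in circ_set mu).
Proof. by rewrite inE; apply: (iffP forallP) => H x; apply/eqP. Qed.

Lemma radicalP mu a : reflect (forall x, mu x a = 0) (a \in radical mu).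
Proof. by rewrite inE; apply: (iffP forallP) => H x; apply/eqP. Qed.

Lemma circ_set_inj mu : {in circ_set mu &, forall s t : {perm 'V_n}, s 0 = t 0 -> s = t}.
Proof.
move=> s t /circ_setP sE /circ_setP tE eq0.
by apply/permP => x; rewrite sE [RHS]tE eq0.
Qed.

Section Facts.
Variable mu : 'V_n -> 'V_n -> 'V_n.
Hypothesis muN : nil_alternating mu.

Lemma prodC x y : mu x y = mu y x.
Proof.
apply: addV_eq0; have := prodxx muN (x + y).
by rewrite (prodDl muN) !(prodDr muN) !(prodxx muN) add0r addr0.
Qed.

Lemma prod0l y : mu 0 y = 0.
Proof. by apply: (addrI (mu 0 y)); rewrite -(prodDl muN) !addr0. Qed.

Lemma prod_nilr x y z : mu x (mu y z) = 0.
Proof. by rewrite prodC (prod_nil muN). Qed.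

(** Applying the map twice adds 2 a + 2 (mu x a) + mu a a + mu (mu x a) a, all
of whose terms vanish. *)
Lemma circ_fun_inv a : involutive (fun x => x + a + mu x a).
Proof.
move=> x; rewrite !(prodDl muN) (prodxx muN) (prod_nil muN) !addr0.
by rewrite (addrAC _ a) !addVK.
Qed.

Definition circ_perm a : {perm 'V_n} := perm (inv_inj (circ_fun_inv a)).

Lemma circ_permE a x : circ_perm a x = x + a + mu x a.
Proof. by rewrite permE. Qed.

Lemma circ_perm0 a : circ_perm a 0 = a.
Proof. by rewrite circ_permE prod0l addr0 add0r. Qed.

Lemma circ_perm_in a : circ_perm a \in circ_set mu.
Proof. by apply/circ_setP=> x; rewrite circ_perm0 circ_permE. Qed.

(** The composite of the permutations with parameters a and b has parameter
a + b + mu a b, and mu _ (mu a b) vanishes. *)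
Lemma circ_group_set : group_set (circ_set mu).
Proof.
apply/group_setP; split=> [|s t /circ_setP sE /circ_setP tE].
  by apply/circ_setP=> x; rewrite !perm1 addr0 prodC prod0l addr0.
apply/circ_setP=> x; rewrite !permM [t (s x)]tE [t (s 0)]tE sE.
rewrite !(prodDr muN, prodDl muN) prod_nilr (prod_nil muN) !addr0 -!addrA.
by congr (_ + (_ + _)); rewrite addrCA; congr (_ + _); rewrite addrA addrC.
Qed.

Canonical circ_group := Group circ_group_set.

Lemma circ_abelem : (2.-abelem circ_group)%g.
Proof.
apply/abelemP=> //; split=> [|s Ts]; last first.
  have s2 : (s ^+ 2)%g 0 = (1%g : {perm 'V_n}) 0.
    rewrite expgS expg1 permM perm1; move/circ_setP: Ts => ->.
    by rewrite addVV (prodxx muN) addr0.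
  exact: circ_set_inj (groupX 2 Ts) (group1 _) s2.
apply/centsP=> s Ts t Tt.
have st : (s * t)%g 0 = (t * s)%g 0.
  rewrite !permM [LHS](elimT (circ_setP _ _) Tt) [RHS](elimT (circ_setP _ _) Ts).
  by rewrite prodC [s 0 + _]addrC.
exact: circ_set_inj (groupM Ts Tt) (groupM Tt Ts) st.
Qed.

(** A fixed point x of the permutation with parameter a satisfies a = mu x a;
substituting this into itself gives a = mu x (mu x a) = 0. *)
Lemma circ_regular : regular circ_group.
Proof.
apply/andP; split.
  apply/imsetP; exists 0; rewrite ?inE //; apply/setP=> a; rewrite inE; apply/esym.
  by apply/imsetP; exists (circ_perm a); rewrite ?circ_perm_in //= /aperm circ_perm0.
apply/forallP=> x; apply/eqP/trivgP/subsetP=> s.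
rewrite inE => /andP[Ts /astab1P]; rewrite /= /aperm => sx; apply/set1P.
have sE := elimT (circ_setP _ _) Ts; rewrite sE -addrA in sx.
have s0E : s 0 = mu x (s 0).
  by apply: addV_eq0; apply: (addrI x); rewrite sx addr0.
have s0 : s 0 = (1%g : {perm 'V_n}) 0 by rewrite perm1 s0E s0E prod_nilr.
exact: circ_set_inj Ts (group1 _) s0.
Qed.

(** The linear part x |-> x + mu x a is invertible because it is the permutation
followed by a translation. *)
Lemma circ_sub_AGL : circ_group \subset AGL n.
Proof.
apply/subsetP=> s /circ_setP sE; pose g := (s * sigma (s 0))%g.
have gE x : g x = x + mu x (s 0).
  by rewrite permM sigmaE sE addrAC addVK.
apply/mulsgP; exists g (sigma (s 0)) => //; last 2 first.
- exact: imset_f.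
- by apply/permP=> x; rewrite !permM !sigmaE addVK.
have [|A gA] := @additive_mx n g; first by move=> x y; rewrite !gE (prodDl muN) addrACA.
rewrite inE; apply/existsP; exists A; apply/andP; split; last first.
  by apply/forallP=> x; apply/eqP.
rewrite -row_free_unit; apply: inj_row_free => v; rewrite -gA => gv.
by apply: (@perm_inj _ g); rewrite gv gE prod0l addr0.
Qed.

(** Conjugation by the translation of vector b changes the parameter a to
a + mu b a, and mu x (a + mu b a) = mu x a. *)
Lemma circ_normal : transl n \subset AGLo circ_group.
Proof.
apply/subsetP=> _ /imsetP[b _ ->]; rewrite inE.
apply/subsetP=> _ /imsetP[s /circ_setP sE ->].
have cE x : (s ^ sigma b)%g x = x + s 0 + mu x (s 0) + mu b (s 0).
  rewrite -[in LHS](addVK x b) -[in LHS](sigmaE b) permJ !sigmaE sE (prodDl muN).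
  by rewrite [_ + b + s 0]addrAC -!addrA; do 2 congr (_ + _); rewrite addrC !addrA addVK.
apply/circ_setP=> x; rewrite !cE prod0l add0r addr0 (prodDr muN) prod_nilr addr0.
by rewrite -!addrA; congr (_ + (_ + _)); rewrite addrC.
Qed.

End Facts.

Lemma W_circ mu : W (circ_set mu) = radical mu.
Proof.
apply/setP=> a; rewrite !inE; apply: eq_forallb => x.
by rewrite !sigmaE add0r -subr_eq0 opprD addrA subrr sub0r oppr_eq0.
Qed.

End ProductToGroup.

(** * From regular groups to products *)

Section GroupToProduct.
Variable n : nat.
Implicit Types (s t : {perm 'V_n}) (x y : 'V_n).

Lemma AGL_affine s : s \in AGL n -> forall x y, s (x + y) = s x + s y + s 0.
Proof.
case/mulsgP=> g t; rewrite inE => /existsP[A /andP[_ /forallP gA]].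
case/imsetP=> b _ ->{t} -> x y.
rewrite !permM !sigmaE !(eqP (gA _)) mulmxDl mul0mx add0r addrACA.
by rewrite addVV addr0.
Qed.

Variable T : {group {perm 'V_n}}.
Hypotheses (abT : abelian T) (T2 : forall s, s \in T -> (s ^+ 2 = 1)%g).
Hypotheses (regT : regular T) (affT : T \subset AGL n).
Hypothesis norT : transl n \subset AGLo T.

Lemma regular_inj : {in T &, forall s t, s 0 = t 0 -> s = t}.
Proof.
move=> s t Ts Tt st; have /andP[_ /forallP/(_ 0)/eqP C1] := regT.
have : (s * t^-1)%g \in 'C_T[0 | 'P]%g.
  rewrite inE groupM ?groupV //=.
  by apply/astab1P; rewrite /= /aperm permM st permK.
by rewrite C1 => /set1P/eqP; rewrite -eq_mulgV1 => /eqP.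
Qed.

Lemma regular_ex a : exists2 s, s \in T & s 0 = a.
Proof.
have /andP[trT _] := regT.
by have [s Ts ->] := atransP2 trT (in_setT 0) (in_setT a); exists s.
Qed.

(** The product attached to the group: x tau_a = x + a + group_prod x a. By
regularity exactly one s can be picked, so the default 1 does not occur. *)
Definition group_prod x a : 'V_n :=
  odflt 1%g [pick s : {perm 'V_n} | (s \in T) && (s 0 == a)] x + x + a.

Lemma group_prodE s x : s \in T -> group_prod x (s 0) = s x + x + s 0.
Proof.
move=> Ts; rewrite /group_prod; case: pickP => [t /andP[Tt /eqP t0]|] /=.
  by rewrite (regular_inj Tt Ts t0).
by move/(_ s); rewrite Ts eqxx.
Qed.

Lemma groupE s x : s \in T -> s x = x + s 0 + group_prod x (s 0).
Proof.
by move=> Ts; rewrite group_prodE // addrC -[s x + x + s 0]addrA addVK.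
Qed.

(** Commutativity of T at 0: x tau_y = 0 tau_x tau_y = 0 tau_y tau_x = y tau_x. *)
Lemma group_prodC x y : group_prod x y = group_prod y x.
Proof.
have [s Ts <-] := regular_ex x; have [t Tt <-] := regular_ex y.
rewrite !group_prodE // -!permM (centsP abT _ Ts _ Tt).
by rewrite -!addrA [s 0 + _]addrC.
Qed.

Lemma group_prodDl x y z : group_prod (x + y) z = group_prod x z + group_prod y z.
Proof.
have [s Ts <-] := regular_ex z; rewrite !group_prodE //.
rewrite (AGL_affine (subsetP affT _ Ts)) addrAC addVK.
by rewrite [RHS]addrACA addVV addr0 [RHS]addrACA.
Qed.

(** Nilpotency comes from the translations: for s in T with parameter y, the
conjugate of s by the translation of vector x is in T and has parameter
y + mu x y, but the same linear part as s; hence mu z (mu x y) = 0. *)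
Lemma group_prod_nil_alternating : nil_alternating group_prod.
Proof.
split=> [|x y z|x|x y z].
- exact: group_prodDl.
- by rewrite !(group_prodC x) group_prodDl.
- have [s Ts <-] := regular_ex x.
  by rewrite group_prodE // -permM -expg2 T2 // perm1 add0r addVV.
have [s Ts <-] := regular_ex y; rewrite group_prodC.
have sbT : (s ^ sigma x)%g \in T.
  by rewrite memJ_norm // (subsetP norT) // imset_f.
have sbE u : (s ^ sigma x)%g u = s u + s 0 + (s x + x).
  rewrite -[in LHS](addVK u x) -[in LHS](sigmaE x) permJ sigmaE.
  by rewrite (AGL_affine (subsetP affT _ Ts)) -!addrA; congr (_ + _); rewrite addrCA.
have sb0 : (s ^ sigma x)%g 0 = s x + x by rewrite sbE addVV add0r.
rewrite (group_prodE _ Ts) -sb0 group_prodC group_prodDl -!(group_prodC z).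
rewrite !group_prodE //.
by rewrite sbE -sb0 [_ + z + (s ^ _)%g 0]addrAC addVK [_ + s 0 + z]addrAC addVV.
Qed.

Lemma circ_set_group_prod : T = circ_set group_prod :> {set _}.
Proof.
apply/setP=> s; apply/idP/circ_setP=> [Ts x | sE]; first exact: groupE.
have [t Tt t0] := regular_ex (s 0).
suff -> : s = t by [].
by apply/permP=> x; rewrite sE (groupE _ Tt) t0.
Qed.

End GroupToProduct.

(** * The groups counted, as products *)

Lemma card_W n (T : {group {perm 'V_n}}) : #|W T| = (2 ^ \dim (Wspace T))%N.
Proof.
transitivity #|Wspace T|; first by apply: eq_card => a; rewrite mem_Wspace.
by rewrite (card_vspace (F := 'F_2)) card_Fp.
Qed.

Lemma circ_groupsP n d (T : {group {perm 'V_n}}) : (0 < n)%N ->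
  reflect (exists mu, [/\ nil_alternating mu, T = circ_set mu :> {set _}
                         & #|W T| = (2 ^ d)%N])
          (T \in circ_groups n d).
Proof.
move=> n_gt0; rewrite inE; apply: (iffP and5P) => [|[mu [muN TE WT]]].
  case=> /is_abelemP[p p_pr abT] regT affT /eqP dimW norT.
  (* The exponent of T is 2 because a regular group has order 2 ^ n. *)
  have p2 : p = 2.
    have p_T := abelem_pgroup abT.
    have /andP[trT /forallP/(_ 0)/eqP C1] := regT.
    have := card_orbit 'P T (0 : 'V_n); rewrite C1 indexg1 (atransP trT) ?inE //.
    rewrite cardsT card_mx card_Fp // mul1n => cT.
    move: p_T; rewrite /pgroup -cT pnatX (negPf (lt0n_neq0 n_gt0)) orbF.
    by rewrite pnatE // inE => /eqP.
  case/(abelemP p_pr): abT => abT; rewrite p2 => T2.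
  exists (group_prod T); split; last by rewrite card_W dimW.
    exact: group_prod_nil_alternating.
  exact: circ_set_group_prod.
have -> : T = circ_group muN by apply: val_inj.
split; first 1 last.
- exact: circ_regular.
- exact: circ_sub_AGL.
- by move/eqP: WT; rewrite card_W eqn_exp2l // TE.
- exact: circ_normal.
by apply/is_abelemP; exists 2 => //; apply: circ_abelem.
Qed.

(** * The variety as the set of nondegenerate alternating forms *)

Lemma sum_sym_alt m (f : 'I_m -> 'I_m -> 'F_2) :
  (forall s i, f s i = f i s) -> (forall i, f i i = 0) ->
  \sum_s \sum_i f s i = 0.
Proof.
move=> fC fii; pose g (s i : 'I_m) := if (i < s)%N then f s i else 0.
(* The terms above the diagonal cancel those below it. *)
rewrite (eq_bigr (fun s => \sum_i g s i + \sum_i g i s)) => [|s _]; last first.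
  rewrite -big_split; apply: eq_bigr => i _; rewrite /g /=.
  by case: ltngtP => [||/val_inj->]; rewrite ?addr0 ?add0r ?fii // fC.
by rewrite big_split /= [X in _ + X]exchange_big addF2.
Qed.

Section Forms.
Variables m d : nat.
Implicit Types (v : {ffun 'I_(nvar m d) -> 'F_2}) (x y z : 'rV['F_2]_m).

Definition bcoef v (s i : 'I_m) (j : 'I_d) : 'F_2 := v (enum_rank (s, i, j)).

Definition form v x y : 'rV['F_2]_d :=
  \row_j \sum_s \sum_i x 0 s * y 0 i * bcoef v s i j.

Lemma formDl v x y z : form v (x + y) z = form v x z + form v y z.
Proof.
apply/rowP=> j; rewrite !mxE -big_split; apply: eq_bigr => s _ /=.
by rewrite -big_split; apply: eq_bigr => i _ /=; rewrite mxE !mulrDl.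
Qed.

Lemma formDr v x y z : form v x (y + z) = form v x y + form v x z.
Proof.
apply/rowP=> j; rewrite !mxE -big_split; apply: eq_bigr => s _ /=.
by rewrite -big_split; apply: eq_bigr => i _ /=; rewrite mxE mulrDr mulrDl.
Qed.

Lemma form0l v y : form v 0 y = 0.
Proof. by apply: (addrI (form v 0 y)); rewrite -formDl !addr0. Qed.

Lemma form0r v x : form v x 0 = 0.
Proof. by apply: (addrI (form v x 0)); rewrite -formDr !addr0. Qed.

Lemma form_deltal v s y j :
  form v (delta_mx 0 s) y 0 j = \sum_i y 0 i * bcoef v s i j.
Proof.
rewrite mxE (bigD1 s) //= [X in _ + X]big1 ?addr0 => [|s' /negPf ss'].
  by apply: eq_bigr => i _; rewrite mxE !eqxx mul1r.
by apply: big1 => i _; rewrite mxE ss' andbF !mul0r.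
Qed.

Lemma form_delta v s i j : form v (delta_mx 0 s) (delta_mx 0 i) 0 j = bcoef v s i j.
Proof.
rewrite form_deltal (bigD1 i) //= [X in _ + X]big1 ?addr0 => [|i' /negPf ii'].
  by rewrite mxE !eqxx mul1r.
by rewrite mxE ii' andbF mul0r.
Qed.

(** A vector over F_2 is the indicator of its support, which turns the sums over
subsets in S1 into values of the form. *)
Lemma sum_supp (z : 'rV['F_2]_m) (f : 'I_m -> 'F_2) :
  \sum_(i in [set i | z 0 i != 0]) f i = \sum_i z 0 i * f i.
Proof.
rewrite [RHS](bigID (fun i => z 0 i != 0)) /= [X in _ + X]big1 ?addr0 => [|i].
  apply: eq_big => i; rewrite inE // => /F2_neq0->.
  by rewrite mul1r.
by rewrite negbK => /eqP->; rewrite mul0r.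
Qed.

Lemma variety_ideal_gen N (S : {mpoly 'F_2[N]} -> Prop) (w : {ffun 'I_N -> 'F_2}) :
  w \in variety (ideal_gen S) <-> forall p, S p -> p.@[w] = 0.
Proof.
rewrite inE; split=> [/asboolP wS p Sp|wS]; first exact/wS/sub_ideal_gen.
apply/asboolP=> p [k [c [g [Sg ->]]]]; rewrite rmorph_sum big1 // => i _ /=.
by rewrite mevalM (wS _ (Sg i)) mulr0.
Qed.

Lemma meval_bvar v s i j : (bvar s i j).@[v] = bcoef v s i j.
Proof. by rewrite mevalXU. Qed.

(** S0 holds for all points over F_2, and S2 and S3 say that the form is
alternating. For such a form a product in S1 vanishes if and only if
some factor 1 + sum_(s in S) b^(s)_(i,j) does, i.e. if and only if some basis
vector e_i pairs nontrivially with the indicator vector of S. *)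
Lemma varietyP v :
  v \in variety (Imd m d) <->
  (forall x, form v x x = 0) /\ (forall z, (forall y, form v y z = 0) -> z = 0).
Proof.
split=> [/variety_ideal_gen vI | [vA vN]].
  have bC s i j : bcoef v s i j = bcoef v i s j.
    apply/eqP; rewrite -subr_eq0 -!meval_bvar -mevalB; apply/eqP/vI/Or43.
    by exists i, s, j.
  have bA i j : bcoef v i i j = 0.
    by rewrite -meval_bvar; apply/vI/Or44; exists i, j.
  split=> [x | z zN].
    apply/rowP=> j; rewrite !mxE; apply: sum_sym_alt => [s i|i].
      by rewrite bC [x 0 s * _]mulrC.
    by rewrite bA mulr0.
  apply/eqP; apply: contraT => z_neq0; pose S := [set i | z 0 i != 0].
  have S_neq0 : S != set0.
    apply: contraNneq z_neq0 => S0; apply/eqP/rowP=> i; rewrite mxE.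
    by have /negbT := in_set0 i; rewrite -S0 inE negbK => /eqP.
  have : (\prod_(i < m) \prod_(j < d) (1 + \sum_(s in S) bvar s i j)).@[v] = 0.
    by apply/vI/Or42; exists S.
  rewrite rmorph_prod big1 => [/eqP|i _]; first by rewrite oner_eq0.
  rewrite rmorph_prod big1 => [//|j _] /=; rewrite mevalD meval1 rmorph_sum /=.
  rewrite (eq_bigr (fun s => bcoef v i s j)) => [|s _]; last by rewrite meval_bvar bC.
  by rewrite sum_supp -form_deltal zN mxE addr0.
have bA i j : bcoef v i i j = 0 by rewrite -form_delta vA mxE.
have bC s i j : bcoef v s i j = bcoef v i s j.
  have := vA (delta_mx 0 s + delta_mx 0 i); rewrite formDl !formDr !vA add0r addr0.
  by move/addV_eq0/rowP/(_ j); rewrite !form_delta.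
apply/variety_ideal_gen=> p [[i [s [j ->]]]|[S S0 ->]|[i [s [j ->]]]|[i [j ->]]].
- rewrite mevalB rmorphXn /= meval_bvar.
  case: (eqVneq (bcoef v s i j) 0) => [->|/F2_neq0->].
    by rewrite expr0n subr0.
  by rewrite expr1n subrr.
- (* If all the sums over S vanished, the indicator vector z of S would be
     orthogonal to all vectors. *)
  have [/existsP[i /existsP[j bS]]|nbS] :=
    boolP [exists i, exists j, \sum_(s in S) bcoef v s i j != 0].
    rewrite rmorph_prod (bigD1 i) //= rmorph_prod (bigD1 j) //= mevalD meval1.
    rewrite rmorph_sum /= (eq_bigr (fun s => bcoef v s i j)) => [|s _].
      by rewrite (F2_neq0 bS) addF2 !mul0r.
    by rewrite meval_bvar.
  pose z : 'rV['F_2]_m := \row_i (i \in S)%:R.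
  have SE : S = [set i | z 0 i != 0].
    by apply/setP=> i; rewrite inE mxE; case: (i \in S); rewrite ?oner_eq0 ?eqxx.
  suff z0 : z = 0.
    by case/eqP: S0; rewrite SE z0; apply/setP=> i; rewrite !inE mxE eqxx.
  apply: vN => y; rewrite [y]row_sum_delta.
  have f_morph : {morph (fun y => form v y z) : a b / a + b} by move=> a b; apply: formDl.
  rewrite (big_morph _ f_morph (form0l v z)) big1 // => s _.
  have [->|/F2_neq0->] := eqVneq (y 0 s) 0; first by rewrite scale0r form0l.
  rewrite scale1r; apply/rowP=> j; rewrite form_deltal mxE -sum_supp -SE.
  move: nbS; rewrite negb_exists => /forallP/(_ s).
  rewrite negb_exists => /forallP/(_ j); rewrite negbK => /eqP bS0.
  by rewrite -[RHS]bS0; apply: eq_bigr => i _; rewrite bC.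
- by rewrite mevalB !meval_bvar bC subrr.
by rewrite meval_bvar bA.
Qed.

End Forms.

(** * Products with a given radical *)

Lemma biadditive_form m d (B : 'rV['F_2]_m -> 'rV['F_2]_m -> 'rV['F_2]_d) :
    (forall x y z, B (x + y) z = B x z + B y z) ->
    (forall x y z, B x (y + z) = B x y + B x z) ->
  exists v : {ffun 'I_(nvar m d) -> 'F_2}, forall x y, B x y = form v x y.
Proof.
move=> BDl BDr; have B0l y : B 0 y = 0.
  by apply: (addrI (B 0 y)); rewrite -BDl !addr0.
have B0r x : B x 0 = 0 by apply: (addrI (B x 0)); rewrite -BDr !addr0.
exists [ffun k => let: (s, i, j) := enum_val k in
                  B (delta_mx 0 s) (delta_mx 0 i) 0 j] => x y.
have BZl c u w : B (c *: u) w = c *: B u w.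
  by have [->|/F2_neq0->] := eqVneq c 0; rewrite ?scale0r ?B0l // !scale1r.
have BZr c u w : B u (c *: w) = c *: B u w.
  by have [->|/F2_neq0->] := eqVneq c 0; rewrite ?scale0r ?B0r // !scale1r.
apply/rowP=> j; rewrite mxE [x in LHS]row_sum_delta.
have Bl w : {morph (fun u => B u w) : a b / a + b} by move=> a b; apply: BDl.
have Br u : {morph B u : a b / a + b} by move=> a b; apply: BDr.
rewrite (big_morph _ (Bl y) (B0l y)) summxE; apply: eq_bigr => s _.
rewrite BZl [y in LHS]row_sum_delta (big_morph _ (Br _) (B0r _)) mxE summxE mulr_sumr.
by apply: eq_bigr => i _; rewrite BZr mxE mulrA /bcoef ffunE enum_rankK.
Qed.

(** The permutation with parameter a determines x |-> mu x a. *)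
Lemma circ_set_prod_inj n (mu nu : 'V_n -> 'V_n -> 'V_n) :
    nil_alternating mu -> circ_set mu = circ_set nu ->
  forall x y, mu x y = nu x y.
Proof.
move=> muN mu_nu x a; have := circ_perm_in muN a.
rewrite mu_nu => /circ_setP/(_ x); rewrite circ_perm0 circ_permE.
exact: addrI.
Qed.

(** The rows of P form a basis of the whole space; the last d of them, the rows
of M, span the prescribed radical, and the first m a complement. *)
Section Frame.
Variables (m d : nat) (P : 'M['F_2]_(m + d)).
Hypothesis uP : P \in unitmx.
Implicit Types (v : {ffun 'I_(nvar m d) -> 'F_2}) (x y a : 'V_(m + d)).

Let C : 'M_(m, m + d) := usubmx P.
Let M : 'M_(d, m + d) := dsubmx P.

Definition fst_coord x : 'rV['F_2]_m := lsubmx (x *m invmx P).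
Definition snd_coord x : 'rV['F_2]_d := rsubmx (x *m invmx P).

Lemma coordE x : x = fst_coord x *m C + snd_coord x *m M.
Proof. by rewrite -mul_row_col hsubmxK vsubmxK mulmxKV. Qed.

Lemma coord_row (y : 'rV_m) (z : 'rV_d) : (y *m C + z *m M) *m invmx P = row_mx y z.
Proof. by rewrite -mul_row_col vsubmxK mulmxK. Qed.

Lemma fst_coordC (y : 'rV_m) : fst_coord (y *m C) = y.
Proof.
by rewrite -[y *m C]addr0 -(mul0mx _ M) /fst_coord coord_row row_mxKl.
Qed.

Lemma fst_coordM z : fst_coord (z *m M) = 0.
Proof.
by rewrite -[z *m M]add0r -(mul0mx _ C) /fst_coord coord_row row_mxKl.
Qed.

Lemma snd_coordM z : snd_coord (z *m M) = z.
Proof.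
by rewrite -[z *m M]add0r -(mul0mx _ C) /snd_coord coord_row row_mxKr.
Qed.

Lemma fst_coordD x y : fst_coord (x + y) = fst_coord x + fst_coord y.
Proof. by rewrite /fst_coord mulmxDl linearD. Qed.

Lemma snd_coordD x y : snd_coord (x + y) = snd_coord x + snd_coord y.
Proof. by rewrite /snd_coord mulmxDl linearD. Qed.

Lemma mem_rowgM x : (x \in rowg M) = (fst_coord x == 0).
Proof.
rewrite inE; apply/submxP/eqP=> [[z ->]|x0]; first exact: fst_coordM.
by exists (snd_coord x); rewrite {1}[x]coordE x0 mul0mx add0r.
Qed.

Definition form_prod v x y : 'V_(m + d) := form v (fst_coord x) (fst_coord y) *m M.

Lemma form_prod_nil v : v \in variety (Imd m d) -> nil_alternating (form_prod v).
Proof.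
move=> /varietyP[vA _]; split=> [x y z|x y z|x|x y z]; rewrite /form_prod.
- by rewrite fst_coordD formDl mulmxDl.
- by rewrite fst_coordD formDr mulmxDl.
- by rewrite vA mul0mx.
- by rewrite fst_coordM form0l mul0mx.
Qed.

Lemma radical_form_prod v :
  v \in variety (Imd m d) -> radical (form_prod v) = rowg M.
Proof.
move=> /varietyP[_ vN]; apply/setP=> a; rewrite mem_rowgM.
apply/radicalP/eqP=> [aR | a0 x]; last by rewrite /form_prod a0 form0r mul0mx.
apply: vN => y; have := aR (y *m C).
by move/(congr1 snd_coord); rewrite snd_coordM fst_coordC /snd_coord mul0mx linear0.
Qed.

(** The values of mu lie in its radical, the span of M, and mu only depends on
its arguments modulo this span: it is thus given by an m x m array of
vectors of coordinates in the basis M. *)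
Lemma form_prod_ex mu : nil_alternating mu -> radical mu = rowg M ->
  exists2 v, v \in variety (Imd m d) & forall x y, mu x y = form_prod v x y.
Proof.
move=> muN muR.
have muM x z : mu x (z *m M) = 0.
  by apply: (elimT (radicalP _ _)); rewrite muR mem_rowgM fst_coordM.
have muC x y : mu x y = mu (fst_coord x *m C) (fst_coord y *m C).
  rewrite {1}[x]coordE {1}[y]coordE (prodDr muN) muM addr0.
  by rewrite (prodC muN) (prodDr muN) muM addr0 (prodC muN).
have muE x y : mu x y = snd_coord (mu x y) *m M.
  have : mu x y \in radical mu by apply/radicalP=> z; apply: prod_nilr.
  by rewrite muR mem_rowgM => /eqP mu0; rewrite {1}[mu x y]coordE mu0 mul0mx add0r.
have [||v vE] := @biadditive_form m d
    (fun y z : 'rV_m => snd_coord (mu (y *m C) (z *m C))).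
- by move=> x y z; rewrite mulmxDl (prodDl muN) snd_coordD.
- by move=> x y z; rewrite mulmxDl (prodDr muN) snd_coordD.
have muv x y : mu x y = form_prod v x y by rewrite /form_prod -vE -muE muC.
exists v => //; apply/varietyP; split=> [x | z zN].
  by rewrite -vE (prodxx muN) /snd_coord mul0mx linear0.
apply/eqP; rewrite -[z]fst_coordC -mem_rowgM -muR; apply/radicalP=> x.
by rewrite muv /form_prod fst_coordC zN mul0mx.
Qed.

Lemma form_prod_inj v w : (forall x y, form_prod v x y = form_prod w x y) -> v = w.
Proof.
move=> vw; apply/ffunP=> k; rewrite -[k]enum_valK; case: (enum_val k) => [[s i] j].
rewrite -/(bcoef v s i j) -/(bcoef w s i j) -!form_delta.
have := vw (delta_mx 0 s *m C) (delta_mx 0 i *m C).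
by move/(congr1 snd_coord); rewrite !snd_coordM !fst_coordC => ->.
Qed.

(** The point v of the variety corresponds to the group of the product
form_prod v. *)
Lemma card_circ_groups_W : (0 < m + d)%N ->
  #|[set T in circ_groups (m + d) d | W T == rowg M]| = #|variety (Imd m d)|.
Proof.
move=> n_gt0.
(* Taking generated subgroups makes F total; on the variety it changes nothing. *)
pose F v : {group _} := <<circ_set (form_prod v)>>%G.
have FE v : v \in variety (Imd m d) -> F v = circ_set (form_prod v) :> {set _}.
  by move/form_prod_nil=> vN; apply: (gen_set_id (circ_group_set vN)).
have cardM : #|rowg M| = (2 ^ d)%N.
  have fM : row_free M.
    apply: inj_row_free => z zM.
    by rewrite -[z]snd_coordM zM /snd_coord mul0mx linear0.
  by rewrite card_rowg (eqP fM) card_Fp.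
rewrite -(card_in_imset (f := F)) => [|v w vV wV /(congr1 val) /= Fvw]; last first.
  apply: form_prod_inj; apply: circ_set_prod_inj; first exact: form_prod_nil.
  by rewrite -!FE //; apply: Fvw.
apply: eq_card => T; rewrite inE; apply/andP/imsetP=> [[]|[v vV ->]].
  move/(circ_groupsP _ _ n_gt0) => [mu [muN TE _]]; rewrite TE W_circ => /eqP muR.
  have [v vV muv] := form_prod_ex muN muR; exists v => //.
  apply: val_inj; rewrite /= TE -[RHS]/(F v : {set _}) FE //.
  by apply/setP=> s; apply/circ_setP/circ_setP => sE x; rewrite {1}sE muv.
have WF : W (F v) = rowg M by rewrite FE // W_circ radical_form_prod.
split; last by rewrite WF.
apply/(circ_groupsP _ _ n_gt0); exists (form_prod v).
by rewrite WF FE //; split=> //; apply: form_prod_nil.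
Qed.

End Frame.

Lemma row_free_complete (F : fieldType) m d (M : 'M[F]_(d, m + d)) :
  row_free M -> exists2 P : 'M_(m + d), P \in unitmx & dsubmx P = M.
Proof.
move=> /eqP rM; have rC : \rank (M^C)%MS = m by rewrite mxrank_compl rM addnK.
exists (col_mx (castmx (rC, erefl) (row_base (M^C)%MS)) M); last by rewrite col_mxKd.
rewrite -row_full_unit -sub1mx -addsmxE.
rewrite (adds_eqmx (eqmx_trans (eqmx_cast _ _) (eq_row_base _)) (eqmx_refl M)).
by rewrite addsmxC sub1mx addsmx_compl_full.
Qed.

(** * Counting bases *)

Lemma row_free_col_mx1 (F : fieldType) k n (v : 'rV[F]_n) (N : 'M[F]_(k, n)) :
  row_free (col_mx v N) = row_free N && ~~ (v <= N)%MS.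
Proof.
rewrite /row_free -addsmxE add1n.
have [vN|vN] := boolP (v <= N)%MS.
  rewrite (addsmx_idPr vN) andbF eqn_leq [X in _ && X]ltnNge.
  by rewrite rank_leq_row andbF.
rewrite andbT mxrank_disjoint_sum ?rank_rV.
  have -> : v != 0 by apply: contraNneq vN => ->; apply: sub0mx.
  by rewrite add1n eqSS.
apply/eqP; rewrite -mxrank_eq0; apply: contraR vN; rewrite -lt0n => r1.
have vcap : \rank (v :&: N)%MS = \rank v.
  apply/eqP; rewrite eqn_leq mxrankS ?capmxSl //.
  exact: leq_trans (rank_leq_row v) r1.
have := capmxSr v N; apply: submx_trans.
by have /mxrank_leqif_sup[_ <-] := capmxSl v N; apply/eqP.
Qed.

(** Given k independent rows in the row space of A, the next row can be any
vector of that space outside their span, which has #|F| ^ k elements. *)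
Lemma card_row_free_sub (F : finFieldType) n k (A : 'M[F]_n) :
  #|[set M : 'M[F]_(k, n) | row_free M && (M <= A)%MS]|
    = (\prod_(i < k) (#|F| ^ \rank A - #|F| ^ i))%N.
Proof.
elim: k => [|k IHk].
  rewrite big_ord0 (eq_card (B := setT)) ?cardsT ?card_mx ?mul0n //.
  by move=> M; rewrite !inE flatmx0 sub0mx /row_free mxrank0.
rewrite big_ord_recr /= -IHk -[k.+1]/(1 + k)%N.
rewrite -[RHS]sum_nat_const -[LHS]sum1_card.
pose h (u : 'M[F]_(k, n) * 'rV[F]_n) : 'M[F]_(1 + k, n) := col_mx u.2 u.1.
rewrite (reindex h) /=; last first.
  exists (fun M => (dsubmx M, usubmx M)) => [[N v] _|M _]; rewrite /h /= ?vsubmxK //.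
  by rewrite col_mxKu col_mxKd.
under eq_bigl => u do rewrite inE row_free_col_mx1 -addsmxE addsmx_sub.
rewrite (eq_bigl (fun u : 'M[F]_(k, n) * 'rV[F]_n =>
  (u.1 \in [set M : 'M[F]_(k, n) | row_free M && (M <= A)%MS])
   && (u.2 \in rowg A :\: rowg u.1))) => [|[N v]]; last first.
  by rewrite !inE /=; case: row_free; case: (v <= N)%MS; rewrite ?andbF ?andbT //= andbC.
rewrite -(pair_big_dep (fun N => N \in [set M : 'M_(k, n) | row_free M && (M <= A)%MS])
           (fun N v => v \in rowg A :\: rowg N) (fun _ _ => 1%N)) /=.
apply: eq_bigr => N; rewrite inE => /andP[/eqP rN NA]; rewrite sum1_card cardsD.
by rewrite (setIidPr _) ?rowgS // !card_rowg rN.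
Qed.

Lemma W_rowg n d (T : {group {perm 'V_n}}) : #|W T| = (2 ^ d)%N ->
  exists2 A : 'M['F_2]_n, \rank A = d & W T = rowg A.
Proof.
move=> cW; have gW : group_set (W T).
  by apply/group_setP; split=> [|a b]; rewrite -!mem_Wspace ?mem0v //; apply: memvD.
have WE : W T = rowg (rowg_mx (W T)) by rewrite (rowg_mxK (Group gW)).
exists (rowg_mx (W T)) => //; have := card_rowg (rowg_mx (W T)).
by rewrite -WE cW card_Fp // => /eqP; rewrite eqn_exp2l // => /eqP.
Qed.

(** A family of d independent vectors of the d-dimensional space W T spans it. *)
Lemma card_bases_W n d (T : {group {perm 'V_n}}) : #|W T| = (2 ^ d)%N ->
  #|[set M : 'M['F_2]_(d, n) | row_free M && (W T == rowg M)]|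
    = (\prod_(i < d) (2 ^ d - 2 ^ i))%N.
Proof.
case/W_rowg=> A rA ->; have := @card_row_free_sub 'F_2 n d A.
rewrite rA card_Fp // => <-; apply: eq_card => M; rewrite !inE.
apply: andb_id2l => /eqP rM; rewrite eqEsubset !rowgS andbC.
have [MA|//] := boolP (M <= A)%MS.
by have [_ <-] := mxrank_leqif_sup MA; rewrite rM rA eqxx.
Qed.

(** * The two counts of groups with a basis of W *)

(** Grouped by T, the pairs (T, M) with M a basis of W T number prod (2 ^ d - 2 ^ i)
for each T; grouped by M, as many as points of the variety for each M. *)
Lemma card_circ_groups m d : (0 < m + d)%N ->
  (#|circ_groups (m + d) d| * \prod_(i < d) (2 ^ d - 2 ^ i)
    = \prod_(i < d) (2 ^ (m + d) - 2 ^ i) * #|variety (Imd m d)|)%N.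
Proof.
move=> n_gt0.
pose R (T : {group {perm 'V_(m + d)}}) (M : 'M['F_2]_(d, m + d)) := W T == rowg M.
transitivity (\sum_(T in circ_groups (m + d) d) \sum_(M | row_free M && R T M) 1)%N.
  rewrite -sum_nat_const; apply: eq_bigr => T /(circ_groupsP _ _ n_gt0)[_ [_ _ cW]].
  by rewrite -(card_bases_W cW) -sum1_card; apply: eq_bigl => M; rewrite inE.
rewrite (exchange_big_dep (fun M => row_free M)) /=; last by move=> T M _ /andP[].
have := @card_row_free_sub 'F_2 (m + d) d 1%:M; rewrite mxrank1 card_Fp // => <-.
rewrite -sum_nat_const; apply: eq_big => [M|M fM]; first by rewrite inE submx1 andbT.
have [P uP PM] := row_free_complete fM.
rewrite -(card_circ_groups_W uP n_gt0) -sum1_card.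
by apply: eq_bigl => T; rewrite inE fM PM.
Qed.

(** In (2 ^ n - 2 ^ i) / (2 ^ d - 2 ^ i), numerator and denominator are divisible
by 2 ^ i; cancelling it leaves the i-th factor of the Gaussian binomial. *)
Lemma gauss_binomE n d : (d <= n)%N ->
  gauss_binom n d * (\prod_(i < d) (2 ^ d - 2 ^ i))%:R
    = (\prod_(i < d) (2 ^ n - 2 ^ i))%:R :> rat.
Proof.
move=> le_dn; rewrite /gauss_binom big_mkord !natr_prod -big_split /=.
have powB k i : (i <= k)%N -> (2 ^ k - 2 ^ i)%:R = 2 ^+ i * (2 ^+ (k - i) - 1) :> rat.
  by move=> le_ik; rewrite natrB ?leq_exp2l // !natrX mulrBr mulr1 -exprD subnKC.
apply: eq_bigr => -[i lt_id] _ /=; rewrite !powB ?(ltnW lt_id) //; last first.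
  exact: leq_trans (ltnW lt_id) le_dn.
rewrite mulrCA divfK // subr_eq0 -natrX Num.Theory.pnatr_eq1 -(expn0 2) eqn_exp2l //.
by rewrite subn_eq0 -ltnNge.
Qed.

Theorem theorem4p6 (n d : nat) (hn : (2 <= n)%N) (hd : (1 <= d <= n)%N) :
  #|circ_groups n d|%:R
    = gauss_binom n d * #|variety (Imd (n - d) d)|%:R :> rat.
Proof.
have /andP[_ le_dn] := hd; pose D := (\prod_(i < d) (2 ^ d - 2 ^ i))%N.
have D_neq0 : D%:R != 0 :> rat.
  rewrite Num.Theory.pnatr_eq0 -lt0n; apply: prodn_gt0 => i.
  by rewrite subn_gt0 ltn_exp2l.
apply: (mulIf D_neq0); rewrite mulrAC gauss_binomE // -!natrM; congr (_%:R).
have := @card_circ_groups (n - d) d; rewrite subnK // => -> //.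
exact: ltnW.
Qed.
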